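(* Let $\mathbb{W}$ be a union of lines and ACM points in $\mathbb{P}^1\times\mathbb{P}^1$ and let $\tau$ be the tuple of the standard generating set $\mathcal{G}(I_{\mathbb{W}})$ listed in the standard order. Suppose $\mathcal{G}(I_{\mathbb{W}})=A\sqcup B$ is an $r$-cut partition with respect to $\tau$, and let $J=\langle A\rangle$, $K=\langle B\rangle$. Then $J\cap K$ is minimally generated by $r$ elements (for $r=0$, $J\cap K=0$).
   Context: $R=\mathbb{C}[x_0,x_1,y_0,y_1]$ is bigraded with $\deg x_i=(1,0)$, $\deg y_i=(0,1)$. For $A=[a_0:a_1]\in\mathbb{P}^1$ let $H_A=a_1x_0-a_0x_1$ and for $B=[b_0:b_1]$ let $V_B=b_1y_0-b_0y_1$; the same symbol denotes the form and its zero set (horizontal, resp. vertical, line or ruling). $I_{A\times B}=\langle H_A,V_B\rangle$, $I_{\mathbb{X}}=\bigcap_{P\in\mathbb{X}}I_P$, and a finite set $\mathbb{X}$ is ACM if $R/I_{\mathbb{X}}$ is Cohen–Macaulay. A union of lines and points is $\mathbb{W}=\{P_1,\dots,P_r,H_1,\dots,H_t,V_1,\dots,V_p\}$ (distinct points, horizontal lines and vertical lines, no point on any of the lines), $\mathbb{X}_{\mathbb{W}}=\{P_1,\dots,P_r\}$, $I_{\mathbb{W}}=\bigcap_iI_{P_i}\cap\bigcap_i\langle H_i\rangle\cap\bigcap_j\langle V_j\rangle$; it is a union of lines and ACM points if $\mathbb{X}_{\mathbb{W}}$ is ACM. For ACM $\mathbb{X}$ with $\pi_1(\mathbb{X})=\{A_1,\dots,A_h\}$,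 $\pi_2(\mathbb{X})=\{B_1,\dots,B_v\}$, labelled so that $\alpha_i=|\{P\in\mathbb{X}:P\in H_{A_i}\}|$ satisfies $\alpha_1\ge\cdots\ge\alpha_h$ and the counts on $V_{B_j}$ are nonincreasing, $I_{\mathbb{X}}$ is minimally generated by $\{H_{A_1}\cdots H_{A_h},\ V_{B_1}\cdots V_{B_v}\}\cup\{H_{A_1}\cdots H_{A_i}V_{B_1}\cdots V_{B_{\alpha_{i+1}}}:\alpha_{i+1}<\alpha_i\}$. The standard generating set of $I_{\mathbb{W}}$ is this set for $\mathbb{X}=\mathbb{X}_{\mathbb{W}}$, each element multiplied by $\Lambda=\prod_iH_i\prod_jV_j$ (just $\{\Lambda\}$ if $\mathbb{X}_{\mathbb{W}}=\emptyset$). The standard order lists these generators by the lexicographic order ($y_0>y_1>x_0>x_1$) of their leading terms, largest first; concretely: $\Lambda V_{B_1}\cdots V_{B_v}$ first, then $\Lambda H_{A_1}\cdots H_{A_i}V_{B_1}\cdots V_{B_{\alpha_{i+1}}}$ for the indices $i$ with $\alpha_{i+1}<\alpha_i$ in increasing order of $i$, and $\Lambda H_{A_1}\cdots H_{A_h}$ last. Given a tuple $\tau=(\tau_1,\dots,\tau_n)$ of distinct elements of a set $X$ and a partition $X=A\sqcup B$: it is a $0$-partition if $A$ or $B$ is empty; otherwise it is an $r$-cut partition with respect to $\tau$, where $r$ is the number of indices $i\in\{1,\dots,n-1\}$ such that exactly one of $\tau_i,\tau_{i+1}$ lies in $A$. A $1$-cut partition is one of the form $A=\{\tau_i:i\le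 j\}$, $B=\{\tau_i:i>j\}$ (or with $A$ and $B$ swapped) for some $1\le j<n$. *)

(* Defs.v *)
From mathcomp Require Import all_boot all_algebra.
From mathcomp Require Import Rstruct.
From mathcomp Require Import complex.
From mathcomp Require Import mpoly.
Set Implicit Arguments. Unset Strict Implicit. Unset Printing Implicit Defensive.
Import GRing.Theory.
Local Open Scope ring_scope.

Definition CC : closedFieldType := complex Rdefinitions.R.
Definition Rg := {mpoly CC[4]}.

Definition x0 : Rg := 'X_(@Ordinal 4 0 isT).
Definition x1 : Rg := 'X_(@Ordinal 4 1 isT).
Definition y0 : Rg := 'X_(@Ordinal 4 2 isT).
Definition y1 : Rg := 'X_(@Ordinal 4 3 isT).

(* ---------- Points of P^1 (given by a representative pair (a0,a1) != (0,0)) ---------- *)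
Definition pt := (CC * CC)%type.
Definition pt_ok (a : pt) : bool := a != (0, 0).
Definition proj_eq (a b : pt) : bool := a.1 * b.2 == a.2 * b.1.

Definition Hform (a : pt) : Rg := a.2 *: x0 - a.1 *: x1.
Definition Vform (b : pt) : Rg := b.2 *: y0 - b.1 *: y1.

Definition ideal := Rg -> Prop.

Definition gen (S : ideal) : ideal :=
  fun f => exists l : seq (Rg * Rg),
    (forall p, p \in l -> S p.2) /\ f = \sum_(p <- l) p.1 * p.2.

Definition gen_seq (gs : seq Rg) : ideal := gen (fun g => g \in gs).

Definition ideal_eq (I J : ideal) : Prop := forall f, I f <-> J f.
Definition ideal_cap (I J : ideal) : ideal := fun f => I f /\ J f.
Definition ideal_sub (I J : ideal) : Prop := forall f, I f -> J f.

Definition is_ideal (I : ideal) : Prop :=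
  I 0 /\ (forall f g, I f -> I g -> I (f + g)) /\ (forall f g, I g -> I (f * g)).

Definition prime_ideal (P : ideal) : Prop :=
  is_ideal P /\ ~ P 1 /\ (forall f g, P (f * g) -> P f \/ P g).

Definition IP (P : pt * pt) : ideal := gen_seq [:: Hform P.1; Vform P.2].
Definition IX (X : seq (pt * pt)) : ideal := fun f => forall P, P \in X -> IP P f.

Definition prime_chain_over (I : ideal) (n : nat) : Prop :=
  exists Ps : nat -> ideal,
    (forall k, (k <= n)%N -> prime_ideal (Ps k) /\ ideal_sub I (Ps k)) /\
    (forall k, (k < n)%N -> ideal_sub (Ps k) (Ps k.+1) /\ ~ ideal_sub (Ps k.+1) (Ps k)).

Definition krull_dim_quot (I : ideal) (d : nat) : Prop :=
  prime_chain_over I d /\ ~ prime_chain_over I d.+1.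

Definition irrelevant : ideal := gen_seq [:: x0; x1; y0; y1].

Definition ideal_add_seq (I : ideal) (fs : seq Rg) : ideal :=
  gen (fun g => I g \/ g \in fs).

Definition regular_seq (I : ideal) (fs : seq Rg) : Prop :=
  (forall i g, (i < size fs)%N ->
     ideal_add_seq I (take i fs) (g * nth 0 fs i) -> ideal_add_seq I (take i fs) g) /\
  ~ ideal_add_seq I fs 1.

Definition has_reg_seq_in_m (I : ideal) (d : nat) : Prop :=
  exists fs : seq Rg, size fs = d /\ (forall f, f \in fs -> irrelevant f) /\ regular_seq I fs.

Definition depth_quot (I : ideal) (d : nat) : Prop :=
  has_reg_seq_in_m I d /\ ~ has_reg_seq_in_m I d.+1.

Definition cohen_macaulay_quot (I : ideal) : Prop :=
  exists d, krull_dim_quot I d /\ depth_quot I d.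

Definition ACM (X : seq (pt * pt)) : Prop := cohen_macaulay_quot (IX X).

Definition union_lines_ACM_points (pts : seq (pt * pt)) (hs vs : seq pt) : Prop :=
  (forall P, P \in pts -> pt_ok P.1 && pt_ok P.2) /\
  (forall a, a \in hs -> pt_ok a) /\
  (forall b, b \in vs -> pt_ok b) /\
  pairwise (fun P Q : pt * pt => ~~ (proj_eq P.1 Q.1 && proj_eq P.2 Q.2)) pts /\
  pairwise (fun a b => ~~ proj_eq a b) hs /\
  pairwise (fun a b => ~~ proj_eq a b) vs /\
  (forall P, P \in pts ->
     (forall a, a \in hs -> ~~ proj_eq P.1 a) /\ (forall b, b \in vs -> ~~ proj_eq P.2 b)) /\
  (* X_W is ACM (the empty set of points is allowed, G(I_W) = {Lambda}) *)
  (pts = [::] \/ ACM pts).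

Definition alpha_cnt (pts : seq (pt * pt)) (a : pt) : nat := count (fun P => proj_eq P.1 a) pts.
Definition beta_cnt (pts : seq (pt * pt)) (b : pt) : nat := count (fun P => proj_eq P.2 b) pts.

Definition std_labelling (pts : seq (pt * pt)) (As Bs : seq pt) : Prop :=
  (forall a, a \in As -> pt_ok a) /\
  (forall b, b \in Bs -> pt_ok b) /\
  pairwise (fun a b => ~~ proj_eq a b) As /\
  pairwise (fun a b => ~~ proj_eq a b) Bs /\
  (forall P, P \in pts -> has (proj_eq P.1) As /\ has (proj_eq P.2) Bs) /\
  (forall a, a \in As -> has (fun P : pt * pt => proj_eq P.1 a) pts) /\
  (forall b, b \in Bs -> has (fun P : pt * pt => proj_eq P.2 b) pts) /\
  sorted geq [seq alpha_cnt pts a | a <- As] /\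
  sorted geq [seq beta_cnt pts b | b <- Bs].

Definition Hprod (As : seq pt) (i : nat) : Rg := \prod_(a <- take i As) Hform a.
Definition Vprod (Bs : seq pt) (j : nat) : Rg := \prod_(b <- take j Bs) Vform b.

Definition Lambda (hs vs : seq pt) : Rg :=
  (\prod_(a <- hs) Hform a) * (\prod_(b <- vs) Vform b).

(* the standard generating set of I_W, listed in the standard order;
   alpha (i) below is alpha_{i+1} of the paper (0-based indexing) *)
Definition std_gens (pts : seq (pt * pt)) (hs vs As Bs : seq pt) : seq Rg :=
  let L := Lambda hs vs in
  let alpha i := alpha_cnt pts (nth (0, 0) As i) in
  let h := size As in
  if pts == [::] then [:: L] else
    [:: L * Vprod Bs (size Bs)] ++
    [seq L * (Hprod As i * Vprod Bs (alpha i)) | i <- iota 1 h.-1 & (alpha i < alpha i.-1)%N] ++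
    [:: L * Hprod As h].

(* number r of cuts of the partition encoded by the mask mk
   (mk_i = true iff tau_i lies in the first block) *)
Definition ncuts (mk : seq bool) : nat :=
  count (fun i => nth false mk i != nth false mk i.+1) (iota 0 (size mk).-1).

Definition min_num_gens (I : ideal) (r : nat) : Prop :=
  (exists gs : seq Rg, size gs = r /\ ideal_eq I (gen_seq gs)) /\
  (forall gs : seq Rg, ideal_eq I (gen_seq gs) -> (r <= size gs)%N).

(* Main.v *)
(* Write the generators as g_k = L h_k v_k, where h_k is an increasing and v_k a
   decreasing chain of products of linear forms in the x's, resp. in the y's. Since forms
   in disjoint sets of variables are coprime, g_0, ..., g_n have only the adjacent
   syzygies coming from lcm(g_k, g_(k+1)), as for monomials in two variables. An element
   of the intersection of J and K is a relation between the two blocks, hence a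
   combination of the lcm(g_k, g_(k+1)) over the cuts k. These lcm's are also of the form
   L h v along two such chains, again strictly monotone, so their syzygies have
   coefficients in the irrelevant ideal and Nakayama gives minimality. *)
Require Import Defs.
From mathcomp Require Import all_boot all_algebra.
From mathcomp Require Import zify ring mpoly.
Set Implicit Arguments. Unset Strict Implicit. Unset Printing Implicit Defensive.
Import GRing.Theory.
Local Open Scope ring_scope.

(** * Coprimality of forms in the [x]'s and forms in the [y]'s *)

(** Modulo [h] each variable is congruent to its substitute, and congruence modulo [h] respects sums
    and products. *)
Lemma comp_mpoly_sub_dvd (K : comNzRingType) (n : nat) (h : {mpoly K[n]})
    (lq : n.-tuple {mpoly K[n]}) :
  (forall i, exists s, 'X_i - tnth lq i = h * s) ->
  forall f, exists s, f - (f \mPo lq) = h * s.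
Proof.
move=> Xh.
have DM f g : (exists s, f - (f \mPo lq) = h * s) ->
    (exists s, g - (g \mPo lq) = h * s) ->
    exists s, f * g - ((f * g) \mPo lq) = h * s.
  move=> [s sP] [t tP]; exists (s * g + (f \mPo lq) * t).
  by rewrite rmorphM mulrDr mulrA -sP mulrCA -tP; ring.
elim/mpolyind=> [|c m p _ _ [s sP]]; first by exists 0; rewrite raddf0 subr0 mulr0.
have [t tP] : exists t, 'X_[m] - ('X_[m] \mPo lq) = h * t.
  rewrite mpolyXE_id; elim/big_ind: _ => [||i _].
  - by exists 0; rewrite rmorph1 subrr mulr0.
  - exact: DM.
  - elim: (m i) => [|k IH]; first by exists 0; rewrite rmorph1 subrr mulr0.
    rewrite exprS; apply: DM IH; rewrite comp_mpolyXU -tnth_nth; exact: Xh.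
exists (c *: t + s); rewrite raddfD /= linearZ /= opprD addrACA -scalerBr tP sP.
by rewrite mulrDr scalerAr.
Qed.

(** The substitution kills [h], hence [e * w]; as [w] survives in a domain, it kills [e], and [e] is
    congruent to its image modulo [h]. *)
Lemma dvd_cancel_subst (K : idomainType) (n : nat) (h : {mpoly K[n]})
    (lq : n.-tuple {mpoly K[n]}) (e w c : {mpoly K[n]}) :
  (forall i, exists s, 'X_i - tnth lq i = h * s) ->
  h \mPo lq = 0 -> w \mPo lq != 0 -> e * w = h * c -> exists s, e = h * s.
Proof.
move=> Xh h0 w0 ew.
have [s sP] := comp_mpoly_sub_dvd Xh e; exists s; rewrite -sP.
suff -> : e \mPo lq = 0 by rewrite subr0.
apply/eqP; move: (congr1 (comp_mpoly lq) ew); rewrite !rmorphM /= h0 mul0r.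
by move/eqP; rewrite mulf_eq0 (negPf w0) orbF.
Qed.

(** Applied to [drop i (take j _)], [hprod] and [vprod] are the quotients of two members of the
    chains [Hprod] and [Vprod]. *)
Definition hprod (l : seq pt) : Rg := \prod_(a <- l) Hform a.
Definition vprod (l : seq pt) : Rg := \prod_(b <- l) Vform b.

Lemma Hform_neq0 (a : pt) : pt_ok a -> Hform a != 0.
Proof.
apply: contraNneq => a0; case: a a0 => a1 a2 /=.
rewrite /Hform /= => a0.
have := congr1 (mcoeff U_(@Ordinal 4 0 isT)) a0.
have := congr1 (mcoeff U_(@Ordinal 4 1 isT)) a0.
rewrite !mcoeffB !mcoeffZ !mcoeffXU !mcoeff0 /= !mulr0 !mulr1 subr0 sub0r.
move=> E1 ->; have -> : a1 = 0 :> CC by rewrite -[a1]opprK E1 oppr0.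
by [].
Qed.

Lemma Vform_neq0 (a : pt) : pt_ok a -> Vform a != 0.
Proof.
apply: contraNneq => a0; case: a a0 => a1 a2 /=.
rewrite /Vform /= => a0.
have := congr1 (mcoeff U_(@Ordinal 4 2 isT)) a0.
have := congr1 (mcoeff U_(@Ordinal 4 3 isT)) a0.
rewrite !mcoeffB !mcoeffZ !mcoeffXU !mcoeff0 /= !mulr0 !mulr1 subr0 sub0r.
move=> E1 ->; have -> : a1 = 0 :> CC by rewrite -[a1]opprK E1 oppr0.
by [].
Qed.

Lemma Hform_dvd_cancel (a : pt) (bs : seq pt) (e c : Rg) :
  pt_ok a -> all pt_ok bs -> e * vprod bs = Hform a * c ->
  exists s, e = Hform a * s.
Proof.
move=> aP bsP.
(* Substituting the solution of [Hform a = 0] for one of the variables [x0], [x1] leaves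
   the [y_i], hence every [Vform], unchanged. *)
have wP (lq : 4.-tuple {mpoly CC[4]}) : lq`_2 = y0 -> lq`_3 = y1 ->
    vprod bs \mPo lq != 0.
  move=> l2 l3; suff -> : vprod bs \mPo lq = vprod bs.
    by rewrite prodf_seq_neq0; apply: sub_all bsP => b /Vform_neq0.
  rewrite rmorph_prod /=; apply: eq_bigr => b _.
  by rewrite raddfB /= !comp_mpolyZ /= !comp_mpolyXU /= l2 l3.
have same (i j : 'I_4) : i = j :> nat ->
    exists s, 'X_i - 'X_j = Hform a * s :> {mpoly CC[4]}.
  by move=> /val_inj ->; exists 0; rewrite subrr mulr0.
(* If [a.2 = 0], the form is a nonzero multiple of [x1], and [x1] is sent to 0; otherwise [x0] is
   sent to [(a.1 / a.2) *: x1]. The inverse of the leading coefficient, up to sign, is the cofactor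
   of the one variable that moves. *)
case: (eqVneq a.2 0) aP => [a20|a20 _].
  rewrite /pt_ok => aP; have a10 : a.1 != 0.
    by apply: contraNneq aP => a10; rewrite [a]surjective_pairing a10 a20.
  apply: (@dvd_cancel_subst CC 4 (Hform a) [tuple x0; 0; y0; y1] _ (vprod bs) c) => //;
    last exact: wP.
  - case; case=> [|[|[|[|//]]]] i4; rewrite (tnth_nth 0) /=.
    + exact: same.
    + exists (- a.1^-1)%:MP; rewrite /Hform a20 scale0r sub0r subr0 mulrC mul_mpolyC.
      rewrite scalerN scaleNr opprK scalerA mulVf // scale1r.
      by congr 'X_(_); apply/val_inj.
    + exact: same.
    + exact: same.
  - by rewrite raddfB /= !comp_mpolyZ /= !comp_mpolyXU /= a20 scale0r scaler0 subr0.
apply: (@dvd_cancel_subst CC 4 (Hform a) [tuple (a.1 / a.2) *: x1; x1; y0; y1]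
  _ (vprod bs) c) => //;
  last exact: wP.
- case; case=> [|[|[|[|//]]]] i4; rewrite (tnth_nth 0) /=.
  + exists (a.2^-1)%:MP; rewrite /Hform [RHS]mulrC mul_mpolyC scalerBr !scalerA mulVf //.
    rewrite scale1r [_ * a.1]mulrC; congr (_ - _).
  + exact: same.
  + exact: same.
  + exact: same.
- by rewrite raddfB /= !comp_mpolyZ /= !comp_mpolyXU /= scalerA mulrCA divff // mulr1 subrr.
Qed.

(** The linear factors are split off one at a time, each being nonzero and hence cancellable. *)
Lemma hprod_dvd_cancel (as_ bs : seq pt) (e c : Rg) :
  all pt_ok as_ -> all pt_ok bs -> e * vprod bs = hprod as_ * c ->
  exists s, e = hprod as_ * s.
Proof.
move=> + bsP; elim: as_ e c => [|a l IH] e c /=.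
  by move=> _ _; exists e; rewrite /hprod big_nil mul1r.
case/andP=> aP lP; rewrite /hprod big_cons -/(hprod l) -mulrA => E.
have [s sP] := Hform_dvd_cancel aP bsP E.
move: E; rewrite sP -mulrA => /(mulfI (Hform_neq0 aP)) /(IH _ _ lP) [t ->].
by exists t; rewrite mulrA.
Qed.

(** * Finitely generated ideals *)

Lemma gen_seq0 (gs : seq Rg) : gen_seq gs 0.
Proof. by exists [::]; rewrite big_nil. Qed.

Lemma gen_seq_nil (f : Rg) : gen_seq [::] f <-> f = 0.
Proof.
split=> [[l [lP ->]]|->]; last by exists [::]; rewrite big_nil.
by case: l lP => [|p l lP]; rewrite ?big_nil //; have := lP _ (mem_head _ _).
Qed.

Lemma gen_seq_cons (g : Rg) (gs : seq Rg) (f : Rg) :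
  gen_seq (g :: gs) f <-> exists c f', gen_seq gs f' /\ f = c * g + f'.
Proof.
split=> [[l [lP ->]]|[c [f' [[l [lP ->]] ->]]]]; last first.
  exists ((c, g) :: l); rewrite big_cons; split=> // p; rewrite inE => /predU1P[->|/lP pl].
    exact: mem_head.
  by rewrite inE pl orbT.
elim: l lP => [|p l IH] lP.
  by exists 0, 0; rewrite big_nil mul0r addr0; split=> //; apply: gen_seq0.
have [q ql|c [f' [f'P E]]] := IH; first by apply: lP; rewrite inE ql orbT.
rewrite big_cons E; have := lP _ (mem_head _ _); rewrite inE => /predU1P[->|pgs].
  by exists (p.1 + c), f'; rewrite mulrDl addrA.
exists c, (p.1 * p.2 + f'); rewrite addrCA; split=> //.
case: f'P => l' [l'P ->]; exists (p :: l'); rewrite big_cons; split=> // q.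
by rewrite inE => /predU1P[->|/l'P].
Qed.

Lemma gen_seqD (gs : seq Rg) (f g : Rg) :
  gen_seq gs f -> gen_seq gs g -> gen_seq gs (f + g).
Proof.
case=> l [lP ->] [m [mP ->]]; exists (l ++ m); rewrite big_cat; split=> // p.
by rewrite mem_cat => /orP[/lP|/mP].
Qed.

Lemma gen_seqM (gs : seq Rg) (c f : Rg) : gen_seq gs f -> gen_seq gs (c * f).
Proof.
case=> l [lP ->]; exists [seq (c * p.1, p.2) | p <- l]; split.
  by move=> _ /mapP[q ql ->] /=; apply: lP.
by rewrite big_map mulr_sumr; apply: eq_bigr => p _; rewrite mulrA.
Qed.

Lemma gen_seqN (gs : seq Rg) (f : Rg) : gen_seq gs f -> gen_seq gs (- f).
Proof. by rewrite -mulN1r; apply: gen_seqM. Qed.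

Lemma gen_seq_mem (gs : seq Rg) (c g : Rg) : g \in gs -> gen_seq gs (c * g).
Proof.
move=> ggs; exists [:: (c, g)]; rewrite big_seq1; split=> // p.
by rewrite inE => /eqP->.
Qed.

Lemma gen_seq_trans (gs gs' : seq Rg) (f : Rg) :
  (forall g, g \in gs -> gen_seq gs' g) -> gen_seq gs f -> gen_seq gs' f.
Proof.
move=> sub [l [lP ->]]; rewrite big_seq.
elim/big_ind: _ => [||p pl]; [exact: gen_seq0|exact: gen_seqD|].
by apply: gen_seqM; apply: sub; apply: lP.
Qed.

Lemma gen_seq_map (T : eqType) (F : T -> Rg) (s : seq T) (gs : seq Rg) (f : Rg) :
  (forall x, x \in s -> gen_seq gs (F x)) -> gen_seq (map F s) f -> gen_seq gs f.
Proof. by move=> sub; apply: gen_seq_trans => _ /mapP[x /sub Fx ->]. Qed.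

Lemma gen_seq_sub (gs gs' : seq Rg) (f : Rg) :
  {subset gs <= gs'} -> gen_seq gs f -> gen_seq gs' f.
Proof. by move=> sub [l [lP ->]]; exists l; split=> // p /lP /sub. Qed.

(** One coefficient per position replaces a list of pairs with arbitrary repetitions, so that
    relations and changes of generators can be handled as vectors and matrices. *)
Lemma gen_seq_coef (gs : seq Rg) (f : Rg) :
  gen_seq gs f -> exists c : nat -> Rg, f = \sum_(i < size gs) c i * gs`_i.
Proof.
elim: gs f => [f /gen_seq_nil->|g gs IH f /gen_seq_cons [c [f' [/IH [d ->] ->]]]].
  by exists (fun=> 0); rewrite big_ord0.
by exists (fun i => if i is j.+1 then d j else c); rewrite big_ord_recl.
Qed.

(** * Nakayama's lemma and minimal generation *)

(** The constant term, that is, reduction modulo the irrelevant ideal. *)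
Definition at_origin (f : Rg) : CC := f.@[fun=> 0].

Lemma at_originM (f g : Rg) : at_origin (f * g) = at_origin f * at_origin g.
Proof. exact: mevalM. Qed.

(* The graded Nakayama lemma: rewriting [G] in terms of [gs] and back is the identity
   modulo syzygies of [G], hence modulo the irrelevant ideal. *)
Lemma size_min_gens (G gs : seq Rg) :
  (forall c : nat -> Rg, \sum_(i < size G) c i * G`_i = 0 ->
     forall i, (i < size G)%N -> at_origin (c i) = 0) ->
  ideal_eq (gen_seq G) (gen_seq gs) -> (size G <= size gs)%N.
Proof.
move=> syz GE.
have /fin_all_exists [M MP] : forall i : 'I_(size G), exists c : nat -> Rg,
    G`_i = \sum_(j < size gs) c j * gs`_j.
  move=> i; apply/gen_seq_coef/GE; rewrite -[G`_i]mul1r.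
  by apply/gen_seq_mem/mem_nth.
have /fin_all_exists [N NP] : forall j : 'I_(size gs), exists c : nat -> Rg,
    gs`_j = \sum_(k < size G) c k * G`_k.
  move=> j; apply/gen_seq_coef/GE; rewrite -[gs`_j]mul1r.
  by apply/gen_seq_mem/mem_nth.
(* Over the residue field the two transition matrices satisfy [A *m B = 1], so the rank bounds
   [size G] by [size gs]. *)
pose A := \matrix_(i < size G, j < size gs) at_origin (M i j).
pose B := \matrix_(j < size gs, k < size G) at_origin (N j k).
apply: (@mulmx1_min _ _ _ A B); apply/matrixP=> i k; rewrite !mxE.
pose c (k : nat) : Rg := (i == k :> nat)%:R - \sum_(j < size gs) M i j * N j k.
have c0 : \sum_(k < size G) c k * G`_k = 0.
  rewrite (eq_bigr _ (fun k _ => mulrBl _ _ _)) sumrB.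
  rewrite (bigD1 i) //= eqxx mul1r big1 ?addr0; last first.
    by move=> l; rewrite -val_eqE eq_sym => /negPf /= ->; rewrite mul0r.
  have -> : G`_i = \sum_(j < size gs) \sum_(k < size G) M i j * (N j k * G`_k).
    rewrite MP; apply: eq_bigr => j _; rewrite -mulr_sumr; congr (_ * _).
    exact: NP.
  apply/eqP; rewrite subr_eq0; apply/eqP; rewrite exchange_big /=.
  apply: eq_bigr => l _; rewrite mulr_suml.
  by apply: eq_bigr => j _; rewrite mulrA.
have := syz c c0 k (ltn_ord k); rewrite /c /at_origin mevalB.
move=> E0; have {E0} E := subr0_eq E0; rewrite -val_eqE.
transitivity (((i == k :> nat)%:R : Rg).@[fun=> 0]); last first.
  by case: (_ == _); rewrite ?meval1 ?meval0.
rewrite E (big_morph _ (mevalD _) (meval0 _)); apply: eq_bigr => j _.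
by rewrite !mxE -at_originM.
Qed.

(** * Staircases and the syzygies of their generators *)

(** Pairs play the role of exponents of monomials in two variables: the numbers of horizontal and
    vertical factors. *)
Definition stair (e d : nat * nat) : bool := (e.1 < d.1)%N && (d.2 < e.2)%N.

(** Within these bounds [take] truncates nothing, so every strict step changes the products by at
    least one linear form. *)
Definition staircase (As Bs : seq pt) (E : seq (nat * nat)) : bool :=
  sorted stair E && all (fun e => (e.1 <= size As)%N && (e.2 <= size Bs)%N) E.

Definition stair_gen (L : Rg) (As Bs : seq pt) (e : nat * nat) : Rg :=
  L * (Hprod As e.1 * Vprod Bs e.2).

Lemma stair_trans : transitive stair.
Proof. by move=> [a b] [c d] [e f]; rewrite /stair /=; lia. Qed.

Lemma staircase_cons (As Bs : seq pt) (e : nat * nat) (E : seq (nat * nat)) :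
  staircase As Bs (e :: E) ->
  [/\ all (stair e) E, (e.1 <= size As)%N, (e.2 <= size Bs)%N & staircase As Bs E].
Proof.
rewrite /staircase /= (path_sortedE stair_trans).
by case/andP=> /andP[? ?] /andP[/andP[? ?] ?]; split=> //; apply/andP.
Qed.

Lemma Hprod_split (As : seq pt) (i j : nat) :
  (i <= j)%N -> Hprod As j = Hprod As i * hprod (drop i (take j As)).
Proof.
by move=> ij; rewrite /Hprod -{1}(cat_take_drop i (take j As)) big_cat take_takel.
Qed.

Lemma Vprod_split (Bs : seq pt) (i j : nat) :
  (i <= j)%N -> Vprod Bs j = Vprod Bs i * vprod (drop i (take j Bs)).
Proof.
by move=> ij; rewrite /Vprod -{1}(cat_take_drop i (take j Bs)) big_cat take_takel.
Qed.

Lemma at_origin_hprod (As : seq pt) (i j : nat) :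
  (i < j <= size As)%N -> at_origin (hprod (drop i (take j As))) = 0.
Proof.
move=> /andP[ij jA].
have : size (drop i (take j As)) != 0%N by rewrite size_drop size_takel // subn_eq0 -ltnNge.
case: (drop _ _) => // a l _; rewrite /hprod big_cons at_originM.
by rewrite /at_origin mevalB !mevalZ !mevalXU !mulr0 subr0 mul0r.
Qed.

Lemma at_origin_vprod (Bs : seq pt) (i j : nat) :
  (i < j <= size Bs)%N -> at_origin (vprod (drop i (take j Bs))) = 0.
Proof.
move=> /andP[ij jB].
have : size (drop i (take j Bs)) != 0%N by rewrite size_drop size_takel // subn_eq0 -ltnNge.
case: (drop _ _) => // b l _; rewrite /vprod big_cons at_originM.
by rewrite /at_origin mevalB !mevalZ !mevalXU !mulr0 subr0 mul0r.
Qed.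

(** The right-hand side here and in [stair_genV] is the lcm of the generators at [e] and [d]; the
    left factors are its two cofactors. *)
Lemma stair_genH (L : Rg) (As Bs : seq pt) (e d : nat * nat) : stair e d ->
  hprod (drop e.1 (take d.1 As)) * stair_gen L As Bs e = stair_gen L As Bs (d.1, e.2).
Proof.
by case/andP=> /ltnW ed _; rewrite /stair_gen /= (Hprod_split As ed); ring.
Qed.

Lemma stair_genV (L : Rg) (As Bs : seq pt) (e d : nat * nat) : stair e d ->
  vprod (drop d.2 (take e.2 Bs)) * stair_gen L As Bs d = stair_gen L As Bs (d.1, e.2).
Proof.
by case/andP=> _ /ltnW ed; rewrite /stair_gen /= (Vprod_split Bs ed); ring.
Qed.

(** All generators from [d] on are divisible by [Hprod As d.1], hence so is [c] times the generator
    at [e]. After cancelling [L * Hprod As e.1], the remaining forms in the [x]'s are coprime to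
    [Vprod Bs e.2] and must divide [c]. *)
Lemma stair_gen_syzygy (L : Rg) (As Bs : seq pt) (e d : nat * nat)
    (E : seq (nat * nat)) (c f : Rg) :
  L != 0 -> all pt_ok As -> all pt_ok Bs -> staircase As Bs [:: e, d & E] ->
  gen_seq [seq stair_gen L As Bs i | i <- d :: E] f ->
  c * stair_gen L As Bs e + f = 0 ->
  exists s, c = hprod (drop e.1 (take d.1 As)) * s.
Proof.
move=> L0 AP BP /staircase_cons[/= /andP[ed _] _ _ /staircase_cons[dE _ _ _]] fE.
have {fE} [t ->] : exists t, f = L * Hprod As d.1 * t.
  have {}fE : gen_seq [:: L * Hprod As d.1] f.
    apply: (gen_seq_map (s := d :: E)) fE => i iE.
    have di : (d.1 <= i.1)%N.
      by move: iE; rewrite inE => /predU1P[->//|/(allP dE)/andP[/ltnW]].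
    rewrite /stair_gen (Hprod_split As di); set P := hprod _.
    have -> : L * (Hprod As d.1 * P * Vprod Bs i.2) =
        P * Vprod Bs i.2 * (L * Hprod As d.1) by ring.
    exact/gen_seq_mem/mem_head.
  case: fE => l [lP ->]; exists (\sum_(p <- l) p.1); rewrite mulr_sumr !big_seq.
  by apply: eq_bigr => p /lP; rewrite inE => /eqP->; rewrite mulrC.
case/andP: (ed) => /ltnW ed1 _; rewrite (Hprod_split As ed1) => /eqP.
rewrite addr_eq0 => /eqP E0.
have LH0 : L * Hprod As e.1 != 0.
  rewrite mulf_neq0 // prodf_seq_neq0; apply/allP=> a /mem_take /(allP AP).
  exact: Hform_neq0.
apply: (@hprod_dvd_cancel _ (take e.2 Bs) _ (- t)).
- by apply/allP=> a /mem_drop /mem_take /(allP AP).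
- by apply/allP=> b /mem_take /(allP BP).
apply: (mulfI LH0); rewrite -[vprod _]/(Vprod Bs e.2).
transitivity (c * stair_gen L As Bs e); first by rewrite /stair_gen; ring.
by rewrite E0; ring.
Qed.

(** The first coefficient is a multiple of a nonempty product of linear forms, so it vanishes at the
    origin; the others follow by induction from a shorter syzygy. *)
Lemma stair_gen_syzygy_origin (L : Rg) (As Bs : seq pt) (E : seq (nat * nat))
    (c : nat -> Rg) :
  L != 0 -> all pt_ok As -> all pt_ok Bs -> staircase As Bs E ->
  \sum_(i < size E) c i * [seq stair_gen L As Bs e | e <- E]`_i = 0 ->
  forall i, (i < size E)%N -> at_origin (c i) = 0.
Proof.
move=> L0 AP BP.
elim: E c => [//|e [|d E] IH] c sE; rewrite big_ord_recl /=.
  rewrite big_ord0 addr0 => /eqP; rewrite mulf_eq0.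
  have /negPf-> : stair_gen L As Bs e != 0.
    rewrite mulf_neq0 // mulf_neq0 // prodf_seq_neq0; apply/allP=> a /mem_take.
    - by move/(allP AP)/Hform_neq0.
    - by move/(allP BP)/Vform_neq0.
  by rewrite orbF => /eqP c0 [|//] _; rewrite c0 /at_origin meval0.
set f := \sum_(_ < _) _ => E0.
have fE : gen_seq [seq stair_gen L As Bs i | i <- d :: E] f.
  rewrite /f; elim/big_ind: _ => [||i _]; [exact: gen_seq0|exact: gen_seqD|].
  by apply/gen_seq_mem/mem_nth; rewrite /= size_map; apply: ltn_ord.
have [s c0] := stair_gen_syzygy L0 AP BP sE fE E0.
have [/= /andP[ed _] _ eB sdE] := staircase_cons sE.
have [_ dA _ _] := staircase_cons sdE.
case/andP: (ed) => ed1 ed2.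
(* The term at [e] becomes a multiple of the generator at [d]. The correction contains a nonempty
   product of linear forms, so [c' 0] and [c 1] agree at the origin. *)
pose c' i := if i is 0 then c 1%N + s * vprod (drop d.2 (take e.2 Bs)) else c i.+1.
have := IH c' sdE; rewrite big_ord_recl /= => IH1.
have {IH1} IH1 : forall i, (i < (size E).+1)%N -> at_origin (c' i) = 0.
  apply: IH1; rewrite mulrDl -mulrA (stair_genV L As Bs ed) -(stair_genH L As Bs ed).
  set X := \sum_(_ < _) _.
  have fX : f = c 1%N * stair_gen L As Bs d + X by rewrite /f big_ord_recl.
  by apply: etrans E0; rewrite fX c0; ring.
case=> [_|[_|i iE]].
- by rewrite c0 at_originM at_origin_hprod ?ed1 // mul0r.
- have /= := IH1 0%N isT.
  by rewrite /at_origin mevalD -!/(at_origin _) at_originM at_origin_vprod ?ed2 // mulr0 addr0.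
- exact: (IH1 i.+1).
Qed.

(** * Least common multiples at the cuts *)

(** Along a staircase [(e2.1, e1.2)] is the componentwise maximum of [e1] and [e2], the exponent of
    their lcm. *)
Fixpoint cuts (mk : seq bool) (E : seq (nat * nat)) : seq (nat * nat) :=
  match mk, E with
  | m1 :: ((m2 :: _) as mk'), e1 :: ((e2 :: _) as E') =>
      if m1 == m2 then cuts mk' E' else (e2.1, e1.2) :: cuts mk' E'
  | _, _ => [::]
  end.

Lemma ncuts_cons (m1 m2 : bool) (mk : seq bool) :
  ncuts [:: m1, m2 & mk] = ((m1 != m2) + ncuts (m2 :: mk))%N.
Proof. by rewrite /ncuts /= (iotaDl 1 0) count_map. Qed.

Lemma size_cuts (mk : seq bool) (E : seq (nat * nat)) :
  size mk = size E -> size (cuts mk E) = ncuts mk.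
Proof.
elim: mk E => [|m1 [|m2 mk] IH] [|e1 [|e2 E]] // [sE].
rewrite ncuts_cons -(IH (e2 :: E)); last by rewrite /= sE.
by rewrite [cuts _ _]/= -/(cuts (m2 :: mk) (e2 :: E)); case: (m1 == m2).
Qed.

(** This symmetry transfers statements about one block to the other. *)
Lemma cuts_negb (mk : seq bool) (E : seq (nat * nat)) :
  cuts (map negb mk) E = cuts mk E.
Proof.
elim: mk E => [|m1 [|m2 mk] IH] [|e1 [|e2 E]] //.
by have /= -> := IH (e2 :: E); rewrite (inj_eq negb_inj).
Qed.

Lemma cuts_staircase (As Bs : seq pt) (mk : seq bool) (E : seq (nat * nat)) :
  staircase As Bs E -> staircase As Bs (cuts mk E).
Proof.
(* The induction also locates the cuts relative to the first step [e]. The second inequality is weak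
   because a cut just after [e] keeps [e.2]; the strict drop to the next step makes successive cuts
   strict. *)
suff cE e F : staircase As Bs (e :: F) -> staircase As Bs (cuts mk (e :: F)) /\
    all (fun d => (e.1 < d.1)%N && (d.2 <= e.2)%N) (cuts mk (e :: F)).
  by case: E => [|e F /cE[]//] _; case: (mk) => [|? []].
elim: mk e F => [|m1 [|m2 mk] IH] e [|d F] // sE.
have [/= /andP[ed _] eA eB sdE] := staircase_cons sE.
have [_ dA dB _] := staircase_cons sdE.
have [IH1 IH2] := IH _ _ sdE; case/andP: ed => ed1 ed2.
rewrite -/(cuts (m2 :: mk) (d :: F)); set C := cuts _ _ in IH1 IH2 *.
have aE : all (fun d => (e.1 < d.1)%N && (d.2 <= e.2)%N) C.
  by apply: sub_all IH2 => x; lia.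
case: eqP => // _; split; last by rewrite /= ed1 leqnn.
case/andP: IH1 => IH1 IH3; rewrite /staircase /= (path_sortedE stair_trans) IH1 IH3.
by rewrite dA eB !andbT; apply: sub_all IH2 => x; rewrite /stair /=; lia.
Qed.

(** At a cut one of the two adjacent generators is selected by [mk], and it divides their lcm. *)
Lemma cuts_sub_mask (L : Rg) (As Bs : seq pt) (mk : seq bool) (E : seq (nat * nat)) (f : Rg) :
  staircase As Bs E -> size mk = size E ->
  gen_seq [seq stair_gen L As Bs e | e <- cuts mk E] f ->
  gen_seq (mask mk [seq stair_gen L As Bs e | e <- E]) f.
Proof.
move=> sE mkE; apply: gen_seq_map => x.
elim: mk E sE mkE => [|m1 [|m2 mk] IH] [|e [|d F]] // sE [mkF].
have [/= /andP[ed _] _ _ sdF] := staircase_cons sE.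
have {}IH := IH (d :: F) sdF (congr1 S mkF).
have {IH} IH : x \in cuts (m2 :: mk) (d :: F) ->
    gen_seq (mask [:: m1, m2 & mk] [seq stair_gen L As Bs e | e <- [:: e, d & F]])
      (stair_gen L As Bs x).
  move/IH; apply: gen_seq_sub => y; case: (m1) => //=.
  by rewrite inE => ->; rewrite orbT.
rewrite -/(cuts (m2 :: mk) (d :: F)); case: eqP => // m12.
rewrite inE => /predU1P[->|//] {IH}; case: m1 m12 => m12.
  by rewrite -(stair_genH L As Bs ed); apply: gen_seq_mem; apply: mem_head.
have -> : m2 by case: (m2) m12.
by rewrite -(stair_genV L As Bs ed); apply: gen_seq_mem; apply: mem_head.
Qed.

(* A relation [f1 + f2 = 0] between the two blocks is pushed down the staircase: its first
   coefficient is a multiple [s * P] with [P * g e = Q * g d], so [g e] can be traded for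
   the next generator [g d], at the cost of a multiple of [lcm (g e) (g d)] when [e] and
   [d] are in different blocks. *)
Lemma cap_mask_sub_cuts (L : Rg) (As Bs : seq pt) (mk : seq bool) (E : seq (nat * nat))
    (f1 f2 : Rg) :
  L != 0 -> all pt_ok As -> all pt_ok Bs -> staircase As Bs E -> size mk = size E ->
  gen_seq (mask mk [seq stair_gen L As Bs e | e <- E]) f1 ->
  gen_seq (mask (map negb mk) [seq stair_gen L As Bs e | e <- E]) f2 ->
  f1 + f2 = 0 -> gen_seq [seq stair_gen L As Bs e | e <- cuts mk E] f1.
Proof.
move=> L0 AP BP.
elim: E mk f1 f2 => [|e [|d F] IH] mk f1 f2.
- by case: mk => // _ _ /gen_seq_nil -> _ _; apply: gen_seq0.
- case: mk => [//|[] [|//]] _ _ /=.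
    by move=> _ /gen_seq_nil -> ; rewrite addr0 => ->; apply: gen_seq0.
  by move=> /gen_seq_nil -> _ _; apply: gen_seq0.
case: mk => [//|m1 [//|m2 mk]] sE mkF f1E f2E f12.
(* As [f1 = - f2] and negating the mask keeps the cuts, the blocks can be exchanged so that [e] lies
   in the first. *)
wlog m1T : m1 m2 mk f1 f2 mkF f1E f2E f12 / m1.
  move=> W; case: m1 mkF f1E f2E => mkF f1E f2E; first exact: (W true m2 mk f1 f2).
  have -> : f1 = - f2 by apply/eqP; rewrite -addr_eq0 f12.
  apply: gen_seqN; rewrite -cuts_negb.
  apply: (W true (~~ m2) (map negb mk) f2 f1) => //; last by rewrite addrC.
  - by rewrite /= size_map.
  - suff -> : map negb [:: true, ~~ m2 & map negb mk] = [:: false, m2 & mk] by [].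
    by rewrite /= negbK (mapK negbK).
case: m1 m1T mkF f1E f2E => // _ [mkF].
rewrite -[mask _ _]/(stair_gen L As Bs e ::
  mask (m2 :: mk) [seq stair_gen L As Bs i | i <- d :: F]).
move=> /gen_seq_cons [c [f1' [f1'E f1D]]].
rewrite -[mask _ _]/(mask (map negb (m2 :: mk)) [seq stair_gen L As Bs i | i <- d :: F]).
move=> f2E.
have [/= /andP[ed _] _ _ sdF] := staircase_cons sE.
have [s cs] : exists s, c = hprod (drop e.1 (take d.1 As)) * s.
  apply: (@stair_gen_syzygy L As Bs e d F c (f1' + f2)) => //.
    by apply: gen_seqD; [apply: gen_seq_sub f1'E|apply: gen_seq_sub f2E] => x /mem_mask.
  by rewrite addrA -f1D.
have {}f1D : f1 = s * stair_gen L As Bs (d.1, e.2) + f1'.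
  by rewrite f1D cs -(stair_genH L As Bs ed); ring.
have mkE : size (m2 :: mk) = size (d :: F) by congr _.+1.
rewrite -/(cuts (m2 :: mk) (d :: F)).
have IH2 := IH (m2 :: mk) _ _ sdF mkE.
(* If [d] is in the block of [e], the multiple of the lcm stays in [f1] as a multiple of the
   generator at [d]. Otherwise it is split off as a cut generator and moved to [f2], which keeps the
   relation. *)
case: m2 {IH mkE} f1'E f2E IH2 => f1'E f2E IH2 /=; rewrite -/(cuts (_ :: mk) (d :: F)).
  apply: (IH2 _ f2) => //; rewrite f1D -(stair_genV L As Bs ed) mulrA.
  by apply: gen_seqD => //; apply: gen_seq_mem; apply: mem_head.
apply/gen_seq_cons; exists s, f1'; split=> //.
apply: (IH2 _ (f2 + s * stair_gen L As Bs (d.1, e.2))) => //; last first.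
  by rewrite -f12 f1D; ring.
apply: gen_seqD => //; rewrite -(stair_genV L As Bs ed) mulrA.
by apply: gen_seq_mem; apply: mem_head.
Qed.

(** * The intersection of the two blocks *)

(** An [f] in both ideals gives the relation [f + (- f) = 0] between the blocks. The cuts again form
    a staircase, so their syzygies vanish at the origin and Nakayama applies. *)
Lemma staircase_cap_min_num_gens (L : Rg) (As Bs : seq pt) (mk : seq bool)
    (E : seq (nat * nat)) :
  L != 0 -> all pt_ok As -> all pt_ok Bs -> staircase As Bs E -> size mk = size E ->
  min_num_gens
    (ideal_cap (gen_seq (mask mk [seq stair_gen L As Bs e | e <- E]))
               (gen_seq (mask (map negb mk) [seq stair_gen L As Bs e | e <- E])))
    (ncuts mk).
Proof.
move=> L0 AP BP sE mkE; set I := ideal_cap _ _; rewrite -(size_cuts mkE).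
have IE : ideal_eq I (gen_seq [seq stair_gen L As Bs e | e <- cuts mk E]).
  move=> f; split=> [[f1 /gen_seqN f2]|fE].
    exact: (cap_mask_sub_cuts L0 AP BP sE mkE f1 f2 (subrr f)).
  split; first exact: cuts_sub_mask fE.
  by apply: cuts_sub_mask; rewrite ?size_map // cuts_negb.
split; first by eexists; split; last exact: IE; rewrite size_map.
move=> gs gsE; rewrite -(size_map (stair_gen L As Bs)); apply: size_min_gens.
  by move=> c; rewrite size_map; apply: stair_gen_syzygy_origin => //; apply: cuts_staircase.
by move=> f; split=> [/IE/gsE|/gsE/IE].
Qed.

(** * The standard generators as a staircase *)

(** The determinant of [a] and [c] is annihilated by both coordinates of [b], one of which is
    nonzero. *)
Lemma proj_eq_trans (b a c : pt) :
  pt_ok b -> proj_eq a b -> proj_eq c b -> proj_eq a c.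
Proof.
case: a b c => [a1 a2] [b1 b2] [c1 c2]; rewrite /proj_eq /pt_ok /= => b0 /eqP ab /eqP cb.
have E2 : (a1 * c2 - a2 * c1) * b2 = 0.
  by rewrite mulrBl -[a2 * c1 * b2]mulrA cb mulrAC ab; ring.
have E1 : (a1 * c2 - a2 * c1) * b1 = 0.
  by rewrite mulrBl -[a1 * c2 * b1]mulrA -cb [a2 * c1 * b1]mulrAC -ab; ring.
rewrite -subr_eq0; apply: contraR b0 => d0.
move/eqP: E1 E2; rewrite mulf_eq0 (negPf d0) => /eqP-> /eqP.
by rewrite mulf_eq0 (negPf d0) => /eqP->.
Qed.

(** Distinct points on one horizontal ruling lie on different vertical ones, so their column indices
    in [Bs] are distinct. *)
Lemma alpha_cnt_le (pts : seq (pt * pt)) (Bs : seq pt) (a : pt) :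
  pt_ok a -> (forall b, b \in Bs -> pt_ok b) ->
  pairwise (fun P Q : pt * pt => ~~ (proj_eq P.1 Q.1 && proj_eq P.2 Q.2)) pts ->
  (forall P, P \in pts -> has (proj_eq P.2) Bs) ->
  (alpha_cnt pts a <= size Bs)%N.
Proof.
move=> a0 B0 ptsP ptsB; rewrite /alpha_cnt -size_filter.
set S := filter _ _; pose col (P : pt * pt) := find (proj_eq P.2) Bs.
have SP P : P \in S -> proj_eq P.1 a /\ has (proj_eq P.2) Bs.
  by rewrite mem_filter => /andP[Pa /ptsB].
rewrite -(size_map col) -[X in (_ <= X)%N](size_iota 0).
apply: uniq_leq_size; last first.
  by move=> _ /mapP[P /SP[_ PB] ->]; rewrite mem_iota /= add0n -has_find.
rewrite uniq_pairwise pairwise_map.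
have Spts : all (mem S) S by apply/allP.
apply: sub_in_pairwise Spts (pairwise_filter _ ptsP) => P Q /SP[Pa PB] /SP[Qa QB] /=.
rewrite (proj_eq_trans a0 Pa Qa) /=; apply: contraNneq => colE.
apply: (@proj_eq_trans (nth (0, 0) Bs (col P))); last 1 first.
- by rewrite colE; apply: nth_find.
- by apply: B0; rewrite mem_nth // -has_find.
- exact: nth_find.
Qed.

(** The invariant [al m.-1 <= e.2] survives a dropped index, where [al] does not change, and turns
    each kept drop into a strict step. Positivity makes the last step, to height 0, strict. *)
Lemma path_stair_steps (al : nat -> nat) (h m n : nat) (e : nat * nat) :
  (forall i, 0 < i < h -> al i <= al i.-1)%N -> (forall i, i < h -> 0 < al i)%N ->
  (e.1 < m)%N -> (m + n)%N = h -> (0 < e.2)%N -> (al m.-1 <= e.2)%N ->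
  path stair e (rcons [seq (i, al i) | i <- iota m n & (al i < al i.-1)%N] (h, 0%N)).
Proof.
move=> alD al0; elim: n m e => [|n IH] m [a b] /= am mn b0 ab.
  by rewrite /stair /= b0; lia.
have am1 := alD m; case: ifP => alm /=; last by apply: IH => /=; lia.
rewrite {1}/stair /= am IH //=; [|lia|by apply: al0; lia].
by rewrite andbT; lia.
Qed.

(** The exponents of the standard generators in standard order; [(0, 0)] encodes [Lambda] alone. *)
Definition std_steps (pts : seq (pt * pt)) (As Bs : seq pt) : seq (nat * nat) :=
  let al i := alpha_cnt pts (nth (0, 0) As i) in
  if pts == [::] then [:: (0, 0)%N] else
    (0%N, size Bs) ::
      rcons [seq (i, al i) | i <- iota 1 (size As).-1 & (al i < al i.-1)%N] (size As, 0%N).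

Lemma std_gensE (pts : seq (pt * pt)) (hs vs As Bs : seq pt) :
  std_gens pts hs vs As Bs =
  [seq stair_gen (Lambda hs vs) As Bs e | e <- std_steps pts As Bs].
Proof.
have H0 : Hprod As 0 = 1 by rewrite /Hprod take0 big_nil.
have V0 : Vprod Bs 0 = 1 by rewrite /Vprod take0 big_nil.
rewrite /std_gens /std_steps; case: ifP => _ /=.
  by rewrite /stair_gen /= H0 V0 !mulr1.
by rewrite map_rcons -cats1 -map_comp /stair_gen /= H0 V0 mul1r mulr1.
Qed.

(** The labelling makes the row counts nonincreasing, each row in [As] contains a point, and
    [alpha_cnt_le] bounds the counts by [size Bs]. *)
Lemma std_steps_staircase (pts : seq (pt * pt)) (hs vs As Bs : seq pt) :
  union_lines_ACM_points pts hs vs -> std_labelling pts As Bs ->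
  staircase As Bs (std_steps pts As Bs).
Proof.
move=> [_ [_ [_ [ptsP _]]]] [A0 [B0 [_ [_ [ptsAB [Apts [_ [Asort _]]]]]]]].
rewrite /std_steps; case: ifP => // pts0.
pose al i := alpha_cnt pts (nth (0, 0) As i); set h := size As.
have h0 : (0 < h)%N.
  case: (pts) pts0 ptsAB => // P l _ /(_ P (mem_head _ _))[]; rewrite /h.
  by case: (As).
have alB i : (i < h)%N -> (al i <= size Bs)%N.
  move=> ih; apply: alpha_cnt_le => //; first exact/A0/mem_nth.
  by move=> P /ptsAB[].
have al0 i : (i < h)%N -> (0 < al i)%N.
  by move=> ih; rewrite -has_count; apply/Apts/mem_nth.
have alD i : (0 < i < h)%N -> (al i <= al i.-1)%N.
  case: i => //= i ih; have geq_tr : transitive geq by move=> x y z; rewrite /geq /=; lia.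
  have := @sorted_ltn_nth _ geq geq_tr 0%N _ Asort i i.+1.
  have ih' : (i < h)%N by apply: ltnW.
  rewrite !inE !size_map => /(_ ih' ih (ltnSn _)).
  by rewrite !(nth_map (0, 0)).
apply/andP; split.
  apply: path_stair_steps => //=; [by rewrite add1n prednK| |exact: alB].
  exact: leq_trans (al0 _ h0) (alB _ h0).
rewrite /= all_rcons /= !leqnn /=; apply/allP => _ /mapP[i + ->] /=.
rewrite mem_filter mem_iota => /andP[_ ih]; have {}ih : (i < h)%N by lia.
by rewrite ltnW // alB.
Qed.

Theorem theorem5p7 (pts : seq (pt * pt)) (hs vs As Bs : seq pt) (mk : seq bool) :
  union_lines_ACM_points pts hs vs ->
  std_labelling pts As Bs ->
  size mk = size (std_gens pts hs vs As Bs) ->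
  min_num_gens
    (ideal_cap (gen_seq (mask mk (std_gens pts hs vs As Bs)))
               (gen_seq (mask (map negb mk) (std_gens pts hs vs As Bs))))
    (ncuts mk).
Proof.
move=> W lab; rewrite std_gensE size_map => mkE.
apply: staircase_cap_min_num_gens => //; last exact: std_steps_staircase W lab.
- case: W => [_ [hs0 [vs0 _]]].
  rewrite mulf_neq0 // prodf_seq_neq0; apply/allP.
    by move=> a /hs0/Hform_neq0.
  by move=> b /vs0/Vform_neq0.
- by apply/allP; case: lab.
- by apply/allP; case: lab => _ [].
Qed.
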